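(* Let $X$ be the Cantor set and let $G\leq \mathrm{Homeo}(X)$ be an ample group with associated Bratteli diagram $B=(V,E)$. Then $G$ is uniformly discrete if and only if there is a telescoping $B'=(V',E')$ of $B$ such that $B'\setminus (V'_0\cup E'_1)$ is a multitree, that is, there are no multiple directed paths between any pair of vertices $v,u\in V'\setminus V'_0$.
   Context: $X$ is the Cantor set and $\mathcal{B}$ the Boolean algebra of clopen subsets of $X$; $\mathrm{Homeo}(X)$ is identified with $\mathrm{Aut}(\mathcal{B})$. For a finite subalgebra $\mathcal{A}\le\mathcal{B}$, $\mathrm{at}(\mathcal{A})$ is its set of atoms (minimal nonzero elements). For $G\le \mathrm{Homeo}(X)$ and a $G$-invariant subalgebra $\mathcal{A}\le \mathcal{B}$, $\mathbf{F}_{\mathcal{A}}(G)$ is the group of all $g\in\mathrm{Homeo}(X)$ for which there are a finite partition $X=U_1\sqcup\dots\sqcup U_n$ with all $U_i\in\mathcal{A}$ and $g_1,\dots,g_n\in G$ with $g|_{U_i}=g_i|_{U_i}$. $G$ is piecewise full on $\mathcal{A}$ if $\mathcal{A}$ is $G$-invariant and $\mathbf{F}_{\mathcal{A}}(G)=G$; $G$ is piecewise full if this holds with $\mathcal{A}=\mathcal{B}$. $G\le\mathrm{Homeo}(X)$ is ample if it is piecewise full, locally finite (every finite subset lies in a finite subgroup), countable, and for every $g\in G$ the fixed-point set $\mathrm{Fix}(g)$ is clopen. $G$ is uniformly discrete if there is a (finite) clopen partition $\mathcal{P}$ of $X$ with $|Gx\cap U|\le 1$ for all $x\in X$, $U\in\mathcal{P}$.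 Associated Bratteli diagram: let $G$ be ample. Write $G=\bigcup_{n\in\mathbb{N}}G_n$ and $\mathcal{B}=\bigcup_{n\in\mathbb{N}}\mathcal{B}_n$ as increasing unions of finite subgroups and finite subalgebras, with $G_0$ trivial, $\mathcal{B}_0=\{\emptyset,X\}$, and, for each $n$, $G_n$ piecewise full on $\mathcal{B}_n$ and the setwise stabiliser in $G_n$ of each atom of $\mathcal{B}_n$ equal to its pointwise stabiliser (such decompositions always exist). Let $\tilde V_n=\mathrm{at}(\mathcal{B}_n)$, and for $n\ge 1$ let $\tilde E_n$ contain one edge $\tilde e$, with source $s(\tilde e)=\tilde v\in\tilde V_{n-1}$ and range $r(\tilde e)=\tilde w\in \tilde V_n$, for each pair with $\tilde w\subseteq\tilde v$. Let $\pi_n:\tilde V_n\to V_n$ be the quotient by the $G_n$-action, and let $\pi_{n+1}:\tilde E_{n+1}\to E_{n+1}$ be the quotient of $\tilde E_{n+1}$ by the induced $G_n$-action. The Bratteli diagram $B=(V,E)$ associated to this decomposition is the directed graded multigraph with $V=\bigsqcup_n V_n$ and $E=\bigsqcup_{n\ge1}E_n$, where the image in $E_{n+1}$ of $\tilde e\in\tilde E_{n+1}$ has source $\pi_n(s(\tilde e))\in V_n$ and range $\pi_{n+1}(r(\tilde e))\in V_{n+1}$. Telescoping: given a strictly increasing sequence $(m_n)_{n\ge 0}$ of natural numbers, the telescoping of $B$ along it is $B'=(V',E')$ with $V'_n=V_{m_n}$ and $E'_n$ ($n\ge1$) the set of all directed paths in $B$ from $V_{m_{n-1}}$ to $V_{m_n}$,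 with source and range the initial and final vertices of the path. Here $B'\setminus (V'_0\cup E'_1)$ is $B'$ with the level $V'_0$ and the edges leaving it removed. *)

(* Defs.v *)
From HB Require Import structures.
From mathcomp Require Import all_boot all_order all_algebra.
From mathcomp Require Import all_classical topology cantor measure.

Set Implicit Arguments.
Unset Strict Implicit.
Unset Printing Implicit Defensive.

Local Open Scope classical_set_scope.

Record homeo (X : topologicalType) := Homeo {
  homeo_fun :> X -> X;
  homeo_inv : X -> X;
  homeoK : cancel homeo_fun homeo_inv;
  homeoVK : cancel homeo_inv homeo_fun;
  homeo_continuous : continuous homeo_fun;
  homeo_inv_continuous : continuous homeo_inv
}.

(* [homeo_inv] is determined by [homeo_fun], so equality of homeomorphisms is
   equality of the underlying maps. *)
Lemma homeo_eq (X : topologicalType) (g h : homeo X) : g =1 h -> g = h.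
Proof.
case: g h => [g gi gK giK cg cgi] [h hi hK hiK ch chi] /= /funext gh.
subst h.
have E : gi = hi by apply/funext => x; rewrite -{1}(hiK x) gK.
subst hi.
by congr Homeo; exact: Prop_irrelevance.
Qed.

Section homeo_group.
Variable X : topologicalType.
Implicit Types g h k : homeo X.

Definition homeo_one : homeo X :=
  @Homeo X idfun idfun (fun=> erefl) (fun=> erefl)
    (fun x => @cvg_id X (nbhs x)) (fun x => @cvg_id X (nbhs x)).

Definition homeo_V g : homeo X :=
  @Homeo X (homeo_inv g) g (@homeoVK _ g) (@homeoK _ g)
    (@homeo_inv_continuous _ g) (@homeo_continuous _ g).

Definition homeo_mul g h : homeo X :=
  @Homeo X (g \o h) (homeo_inv h \o homeo_inv g)
    (can_comp (@homeoK _ g) (@homeoK _ h))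
    (can_comp (@homeoVK _ h) (@homeoVK _ g))
    (fun x => continuous_comp (@homeo_continuous _ h x)
                              (@homeo_continuous _ g (h x)))
    (fun x => continuous_comp (@homeo_inv_continuous _ g x)
                              (@homeo_inv_continuous _ h (homeo_inv g x))).

Lemma homeo_mulA : associative homeo_mul.
Proof. by move=> g h k; exact: homeo_eq. Qed.

Lemma homeo_mul1 : left_id homeo_one homeo_mul.
Proof. by move=> g; exact: homeo_eq. Qed.

Lemma homeo_mulr1 : right_id homeo_one homeo_mul.
Proof. by move=> g; exact: homeo_eq. Qed.

Lemma homeo_mulV : left_inverse homeo_one homeo_V homeo_mul.
Proof. by move=> g; apply: homeo_eq => x; exact: homeoK. Qed.

Lemma homeo_mulrV : right_inverse homeo_one homeo_V homeo_mul.
Proof. by move=> g; apply: homeo_eq => x; exact: homeoVK. Qed.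

HB.instance Definition _ := gen_eqMixin (homeo X).
HB.instance Definition _ := gen_choiceMixin (homeo X).
HB.instance Definition _ := isGroup.Build (homeo X)
  homeo_mulA homeo_mul1 homeo_mulr1 homeo_mulV homeo_mulrV.

End homeo_group.

Definition subgroup (X : topologicalType) (G : set (homeo X)) : Prop :=
  group_closed (mem G).

Definition subalgebra (X : topologicalType) (A : set (set X)) : Prop :=
  [/\ A `<=` clopen, A set0, setC_closed A & setU_closed A].

Definition atoms (X : topologicalType) (A : set (set X)) : set (set X) :=
  [set a | [/\ A a, a !=set0 &
               forall b, A b -> b !=set0 -> b `<=` a -> b = a]].

Section orbits.
Variable X : topologicalType.

Definition act_point (g : homeo X) (x : X) : X := g x.
Definition act_set (g : homeo X) (U : set X) : set X := g @` U.
Definition act_pair (g : homeo X) (e : set X * set X) : set X * set X :=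
  (g @` e.1, g @` e.2).

Variables (T : Type) (act : homeo X -> T -> T).

Definition gorbit (G : set (homeo X)) (t : T) : set T := [set act g t | g in G].

(* The set of [G]-orbits of elements of [S]; meant for [G]-invariant [S]. *)
Definition quot (G : set (homeo X)) (S : set T) : set (set T) :=
  [set gorbit G s | s in S].

Definition gproj (G : set (homeo X)) (S : set T) (s : S) : quot G S :=
  SigSub (mem_set (imageP (gorbit G) (set_valP s))).

Definition act_invariant (G : set (homeo X)) (S : set T) : Prop :=
  forall g s, G g -> S s -> S (act g s).

End orbits.

Section groups.
Variable X : topologicalType.
Implicit Types (G H : set (homeo X)) (A : set (set X)).

(* F_A(G) *)
Definition piecewise A G : set (homeo X) :=
  [set g | exists n (U : 'I_n -> set X) (h : 'I_n -> homeo X),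
     [/\ partition [set: 'I_n] U [set: X],
         forall i, A (U i),
         forall i, G (h i) &
         forall i x, U i x -> g x = h i x]].

Definition piecewise_full_on A G : Prop :=
  act_invariant (@act_set X) G A /\ piecewise A G = G.

Definition piecewise_full G : Prop := piecewise_full_on clopen G.

Definition locally_finite G : Prop :=
  forall F, finite_set F -> F `<=` G ->
    exists H, [/\ subgroup H, finite_set H, F `<=` H & H `<=` G].

Definition fixed_set (g : homeo X) : set X := [set x | g x = x].

Definition ample G : Prop :=
  [/\ subgroup G, piecewise_full G, locally_finite G, countable G &
      forall g, G g -> clopen (fixed_set g)].

Definition uniformly_discrete G : Prop :=
  exists n (P : 'I_n -> set X),
    [/\ partition [set: 'I_n] P [set: X],
        forall i, clopen (P i) &
        forall x i, is_subset1 (gorbit (@act_point X) G x `&` P i)].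

Definition setwise_stab G (a : set X) : set (homeo X) :=
  [set g | G g /\ g @` a = a].

Definition pointwise_stab G (a : set X) : set (homeo X) :=
  [set g | G g /\ forall x, a x -> g x = x].

Record decomposition G := Decomposition {
  dgrp : nat -> set (homeo X);
  dalg : nat -> set (set X);
  dgrp_subgroup : forall n, subgroup (dgrp n);
  dgrp_finite : forall n, finite_set (dgrp n);
  dgrp_incr : forall n, dgrp n `<=` dgrp n.+1;
  dgrp_union : \bigcup_n dgrp n = G;
  dalg_subalgebra : forall n, subalgebra (dalg n);
  dalg_finite : forall n, finite_set (dalg n);
  dalg_incr : forall n, dalg n `<=` dalg n.+1;
  dalg_union : \bigcup_n dalg n = clopen;
  dgrp0 : dgrp 0 = [set 1%g];
  dalg0 : dalg 0 = [set set0; setT];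
  dgrp_full : forall n, piecewise_full_on (dalg n) (dgrp n);
  dgrp_stab : forall n a, atoms (dalg n) a ->
    setwise_stab (dgrp n) a = pointwise_stab (dgrp n) a
}.

End groups.

(* [edge n] is the set of edges from level [n] to level [n.+1], usually
   written E_{n+1}. *)
Record graded_graph := GradedGraph {
  vertex : nat -> Type;
  edge : nat -> Type;
  edge_src : forall n, edge n -> vertex n;
  edge_rng : forall n, edge n -> vertex n.+1
}.

Inductive dipath (B : graded_graph) (n : nat) (v : vertex B n) :
    forall k, vertex B k -> Type :=
| dipath_nil : dipath v v
| dipath_rcons k (e : edge B k) : dipath v (edge_src e) -> dipath v (edge_rng e).

Definition multitree (B : graded_graph) : Prop :=
  forall n k (v : vertex B n) (u : vertex B k) (p q : dipath v u), p = q.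

(* Meant for strictly increasing [m]. *)
Definition telescoping (B : graded_graph) (m : nat -> nat) : graded_graph :=
  @GradedGraph
    (fun n => vertex B (m n))
    (fun n => {v : vertex B (m n) & {w : vertex B (m n.+1) & dipath v w}})
    (fun n p => projT1 p)
    (fun n p => projT1 (projT2 p)).

(* Removal of the level 0 vertices and of the edges leaving them; level [n] of
   the result is level [n.+1] of [B]. *)
Definition drop_level0 (B : graded_graph) : graded_graph :=
  @GradedGraph
    (fun n => vertex B n.+1)
    (fun n => edge B n.+1)
    (fun n e => edge_src e)
    (fun n e => edge_rng e).

Section bratteli.
Variables (X : topologicalType) (G : set (homeo X)) (D : decomposition G).

Definition tvertex n : set (set X) := atoms (dalg D n).
(* The edge from [v] to [w] is encoded as the pair [(v, w)]. *)
Definition tedge n : set (set X * set X) :=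
  [set e | [/\ tvertex n e.1, tvertex n.+1 e.2 & e.2 `<=` e.1]].

Definition bvertex n : Type := quot (@act_set X) (dgrp D n) (tvertex n).
Definition bedge n : Type := quot (@act_pair X) (dgrp D n) (tedge n).

Lemma tedge_source_subproof n (e : tedge n) : (val e).1 \in tvertex n.
Proof. by case: e => e /= /set_mem[ev _ _]; exact/mem_set. Qed.

Lemma tedge_range_subproof n (e : tedge n) : (val e).2 \in tvertex n.+1.
Proof. by case: e => e /= /set_mem[_ ev _]; exact/mem_set. Qed.

Definition tsource n (e : tedge n) : tvertex n :=
  SigSub (tedge_source_subproof e).
Definition trange n (e : tedge n) : tvertex n.+1 :=
  SigSub (tedge_range_subproof e).

(* The source of an orbit of edges is the (single) orbit of the sources of its
   members, and likewise for the ranges; see [bsource_proj] and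
   [brange_proj]. *)
Definition source_orbit n (O : set (set X * set X)) : set (set X) :=
  \bigcup_(e in O) gorbit (@act_set X) (dgrp D n) e.1.
Definition range_orbit n (O : set (set X * set X)) : set (set X) :=
  \bigcup_(e in O) gorbit (@act_set X) (dgrp D n.+1) e.2.

Lemma orbit_act_set n (g : homeo X) U : dgrp D n g ->
  gorbit (@act_set X) (dgrp D n) (g @` U) = gorbit (@act_set X) (dgrp D n) U.
Proof.
move=> Gg; have grp := dgrp_subgroup D n.
have GM h k : dgrp D n h -> dgrp D n k -> dgrp D n (h * k)%g.
  by move=> hG kG; have := group_closedM grp (mem_set hG) (mem_set kG);
    move=> /set_mem.
have GV : dgrp D n (g^-1)%g.
  by have := group_closedV grp (mem_set Gg); move=> /set_mem.
apply/seteqP; split => _ [h Gh <-].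
  by exists (h * g)%g; [exact: GM|rewrite /act_set image_comp].
exists (h * g^-1)%g; first exact: GM.
rewrite /act_set image_comp; congr (_ @` _); apply/funext => x /=.
by congr (h _); exact: homeoK.
Qed.

Lemma dgrp1 n : dgrp D n 1%g.
Proof. by have [/set_mem] := dgrp_subgroup D n. Qed.

Lemma act_pair1 (e : set X * set X) : act_pair 1%g e = e.
Proof. by case: e => a b; rewrite /act_pair /= !image_id. Qed.

Lemma source_orbitE n (e : set X * set X) :
  source_orbit n (gorbit (@act_pair X) (dgrp D n) e) =
  gorbit (@act_set X) (dgrp D n) e.1.
Proof.
apply/seteqP; split => [a [_ [g Gg <-]] /=|a Oa].
  by rewrite orbit_act_set.
by exists e => //; exists 1%g; [exact: dgrp1|exact: act_pair1].
Qed.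

Lemma range_orbitE n (e : set X * set X) :
  range_orbit n (gorbit (@act_pair X) (dgrp D n) e) =
  gorbit (@act_set X) (dgrp D n.+1) e.2.
Proof.
apply/seteqP; split => [a [_ [g Gg <-]] /=|a Oa].
  by rewrite orbit_act_set//; exact: dgrp_incr.
by exists e => //; exists 1%g; [exact: dgrp1|exact: act_pair1].
Qed.

Lemma bsource_subproof n (O : bedge n) :
  source_orbit n (val O) \in quot (@act_set X) (dgrp D n) (tvertex n).
Proof.
case: O => O /= /set_mem[e [ev _ _] <-].
by apply/mem_set; exists e.1 => //; rewrite source_orbitE.
Qed.

Lemma brange_subproof n (O : bedge n) :
  range_orbit n (val O) \in
  quot (@act_set X) (dgrp D n.+1) (tvertex n.+1).
Proof.
case: O => O /= /set_mem[e [_ ev _] <-].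
by apply/mem_set; exists e.2 => //; rewrite range_orbitE.
Qed.

Definition bsource n (O : bedge n) : bvertex n := SigSub (bsource_subproof O).
Definition brange n (O : bedge n) : bvertex n.+1 :=
  SigSub (brange_subproof O).

Definition bratteli : graded_graph := @GradedGraph bvertex bedge bsource brange.

Lemma bsource_proj n (e : tedge n) :
  bsource (gproj (@act_pair X) (dgrp D n) e) =
  gproj (@act_set X) (dgrp D n) (tsource e).
Proof. by apply: val_inj; rewrite /= source_orbitE. Qed.

Lemma brange_proj n (e : tedge n) :
  brange (gproj (@act_pair X) (dgrp D n) e) =
  gproj (@act_set X) (dgrp D n.+1) (trange e).
Proof. by apply: val_inj; rewrite /= range_orbitE. Qed.

End bratteli.

(* Main.v *)
(** Since the stabiliser of an atom [a] of [B_n] in [G_n] fixes [a] pointwise,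
    a path in the Bratteli diagram from the orbit of [a] to the orbit of an atom
    [b] of [B_k] lifts uniquely to a chain of atoms starting at [a], and such a
    chain is determined by its last member.  Hence the paths between two
    vertices correspond to the atoms of [B_k] inside [a] lying in the
    [G_k]-orbit of [b].  So, after telescoping and deleting the first level, the
    diagram is a multitree precisely when no two distinct small atoms inside one
    atom of [B_N] are identified by [G], where [N] is the first level kept; this
    is uniform discreteness with respect to the atoms of [B_N]. *)
Require Import Defs.
From mathcomp Require Import all_boot all_classical topology cantor.

Set Implicit Arguments.
Unset Strict Implicit.
Unset Printing Implicit Defensive.

Local Open Scope classical_set_scope.
Local Obligation Tactic := idtac.

(** The index type is arbitrary, without decidable equality; proof irrelevance makes the induced
    equality [i = i] trivial, so no transport remains. *)
Lemma existT_injr (I : Type) (P : I -> Type) (i : I) (x y : P i) :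
  existT P i x = existT P i y -> x = y.
Proof.
move=> E; have := projT2_eq E.
by rewrite (Prop_irrelevance (projT1_eq E) erefl).
Qed.

Lemma dipath_leq (B : graded_graph) n (v : vertex B n) k (u : vertex B k) :
  dipath v u -> (n <= k)%N.
Proof. by elim=> // k' e _; exact: leqW. Qed.

(** * Covers of graded graphs by trees of sets *)

(* [lifts e a b]: the edge from the cell [a] to the cell [b] of the covering
   tree lies above the edge [e] of [B]. *)
Record tree_cover (X : Type) (B : graded_graph) := TreeCover {
  cell : nat -> Type;
  cell_set : forall n, cell n -> set X;
  cell_vertex : forall n, cell n -> vertex B n;
  lifts : forall n, edge B n -> cell n -> cell n.+1 -> Prop;
  cell_nonempty : forall n (a : cell n), cell_set a !=set0;
  cell_disjoint : forall n (a b : cell n) x,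
    cell_set a x -> cell_set b x -> a = b;
  cell_vertex_surj : forall n (v : vertex B n), exists a, cell_vertex a = v;
  lifts_src : forall n (e : edge B n) a b,
    lifts e a b -> cell_vertex a = edge_src e;
  lifts_rng : forall n (e : edge B n) a b,
    lifts e a b -> cell_vertex b = edge_rng e;
  lifts_sub : forall n (e : edge B n) a b,
    lifts e a b -> cell_set b `<=` cell_set a;
  lifts_edge : forall n (e e' : edge B n) a b,
    lifts e a b -> lifts e' a b -> e = e';
  lifts_ex : forall n (e : edge B n) a,
    cell_vertex a = edge_src e -> exists b, lifts e a b;
  lifts_uniq : forall n (e : edge B n) a b b',
    lifts e a b -> lifts e a b' -> b = b';
  lifts_surj : forall n (b : cell n.+1), exists e a, lifts e a b
}.

(** * Unique lifting of paths *)

Section path_lifting.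
Variables (X : Type) (B : graded_graph) (C : tree_cover X B).

Fixpoint path_lifts n (v : vertex B n) k (u : vertex B k) (p : dipath v u) :
    cell C n -> cell C k -> Prop :=
  match p in @dipath _ _ _ k' _ return cell C n -> cell C k' -> Prop with
  | dipath_nil => fun a b => a = b /\ cell_vertex a = v
  | dipath_rcons k' e q => fun a b => exists c, path_lifts q a c /\ lifts e c b
  end.

Section fixed_source.
Variables (n : nat) (v : vertex B n).

Lemma path_lifts_src k (u : vertex B k) (p : dipath v u) a b :
  path_lifts p a b -> cell_vertex a = v.
Proof. by elim: p b => [b []|k' e p IH b [c [/IH]]]. Qed.

Lemma path_lifts_rng k (u : vertex B k) (p : dipath v u) a b :
  path_lifts p a b -> cell_vertex b = u.
Proof. by case: p b => [b [<-]|k' e p b [c [_ /lifts_rng]]]. Qed.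

Lemma path_lifts_sub k (u : vertex B k) (p : dipath v u) a b :
  path_lifts p a b -> cell_set b `<=` cell_set a.
Proof.
elim: p b => [b [-> _]//|k' e p IH b [c [/IH ca /lifts_sub bc]]].
exact: subset_trans ca.
Qed.

Lemma path_lifts_ex k (u : vertex B k) (p : dipath v u) a :
  cell_vertex a = v -> exists b, path_lifts p a b.
Proof.
move=> av; elim: p => [|k' e p [c pc]]; first by exists a.
by have [b eb] := lifts_ex (path_lifts_rng pc); exists b, c.
Qed.

Lemma path_lifts_uniq k (u : vertex B k) (p : dipath v u) a b b' :
  path_lifts p a b -> path_lifts p a b' -> b = b'.
Proof.
elim: p b b' => [b b' [<- _] [<- _]//|k' e p IH b b' [c [pc ec]] [c' [pc']]].
by rewrite -(IH _ _ pc pc'); exact: lifts_uniq ec.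
Qed.

Let total_path k (u : vertex B k) (p : dipath v u) :
    {k : nat & {u : vertex B k & dipath v u}} :=
  existT (fun k => {u : vertex B k & dipath v u}) k
    (existT (fun u => dipath v u) u p).

(* Stated for paths with a priori different endpoints so that the induction on
   [p] can be matched by a case analysis of [q]. *)
Let total_path_lifts_inj k (u : vertex B k) (p : dipath v u)
    k' (u' : vertex B k') (q : dipath v u') a b b' :
  existT (cell C) k b = existT (cell C) k' b' ->
  path_lifts p a b -> path_lifts q a b' -> total_path p = total_path q.
Proof.
elim: p k' u' q b b' => [|i e p IH] k' u' [|i' e' q] b b' bb'.
- by [].
- exfalso; have := dipath_leq q.
  by rewrite (projT1_eq bb' : n = i'.+1) ltnn.
- exfalso; have := dipath_leq p.
  by rewrite -(projT1_eq bb' : i.+1 = n) ltnn.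
- have [ii'] := projT1_eq bb'; subst i'.
  have eb := existT_injr bb'; subst b'.
  move=> /= [c [pc ec]] [c' [qc' ec']].
  have [x bx] := cell_nonempty b.
  (* Both parents contain the nonempty cell [b], so they meet and disjointness identifies them.
     Ancestors of a cell are thus unique, and so is the edge below each step. *)
  have cc' : c = c'.
    exact: cell_disjoint (lifts_sub ec bx) (lifts_sub ec' bx).
  subst c'; have ee' := lifts_edge ec ec'; subst e'.
  have pq := IH _ _ q _ _ erefl pc qc'.
  by rewrite (existT_injr (existT_injr pq)).
Qed.

Lemma path_lifts_inj k (u : vertex B k) (p q : dipath v u) a b :
  path_lifts p a b -> path_lifts q a b -> p = q.
Proof.
move=> pa qa; have pq := total_path_lifts_inj erefl pa qa.
exact: existT_injr (existT_injr pq).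
Qed.

End fixed_source.

Lemma path_lifts_surj n k (b : cell C k) : (n <= k)%N ->
  exists (v : vertex B n) (u : vertex B k) (p : dipath v u) a,
    path_lifts p a b.
Proof.
elim: k b => [|k IH] b; rewrite leq_eqVlt => /predU1P[nk|//].
- by subst n; exists _, _, (dipath_nil (cell_vertex b)), b.
- by subst n; exists _, _, (dipath_nil (cell_vertex b)), b.
- rewrite ltnS => nk; have [e [c ecb]] := lifts_surj b.
  have [v [u [p [a pac]]]] := IH c nk.
  have uE : u = edge_src e by rewrite -(lifts_src ecb) (path_lifts_rng pac).
  by subst u; exists v, _, (dipath_rcons p), a, c.
Qed.

End path_lifting.

(** * Covers of telescopings and truncations, and the multitree criterion *)

Section derived_covers.
Variables (X : Type) (B : graded_graph) (C : tree_cover X B).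

(** An edge of the telescoping is a path of [B], so each field is a path-lifting property.
    Monotonicity of [m] lets a cell of level [m n.+1] be traced back to level [m n]. *)
Program Definition telescoping_cover (m : nat -> nat)
    (m_incr : {homo m : i j / (i < j)%N}) : tree_cover X (telescoping B m) :=
  @TreeCover X (telescoping B m) (fun n => cell C (m n))
    (fun n a => cell_set a) (fun n a => cell_vertex a)
    (fun n e a b => path_lifts (projT2 (projT2 e)) a b)
    _ _ _ _ _ _ _ _ _ _.
Next Obligation. by move=> m _ n a; exact: cell_nonempty. Qed.
Next Obligation. by move=> m _ n a b x; exact: cell_disjoint. Qed.
Next Obligation. by move=> m _ n v; exact: cell_vertex_surj. Qed.
Next Obligation. by move=> m _ n e a b; exact: path_lifts_src. Qed.
Next Obligation. by move=> m _ n e a b; exact: path_lifts_rng. Qed.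
Next Obligation. by move=> m _ n e a b; exact: path_lifts_sub. Qed.
Next Obligation.
move=> m _ n [v [u p]] [v' [u' q]] a b /= pab qab.
have vv' : v = v' by rewrite -(path_lifts_src pab) (path_lifts_src qab).
have uu' : u = u' by rewrite -(path_lifts_rng pab) (path_lifts_rng qab).
by subst v' u'; rewrite (path_lifts_inj pab qab).
Qed.
Next Obligation.
by move=> m _ n [v [u p]] a; exact: (path_lifts_ex p).
Qed.
Next Obligation. by move=> m _ n e a b b'; exact: path_lifts_uniq. Qed.
Next Obligation.
move=> m m_incr n b.
have [v [u [p [a pab]]]] := path_lifts_surj b (ltnW (m_incr _ _ (ltnSn n))).
by exists (existT _ v (existT _ u p)), a.
Qed.

Definition drop_level0_cover : tree_cover X (drop_level0 B) :=
  @TreeCover X (drop_level0 B) (fun n => cell C n.+1)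
    (fun n => @cell_set _ _ C n.+1) (fun n => @cell_vertex _ _ C n.+1)
    (fun n => @lifts _ _ C n.+1)
    (fun n => @cell_nonempty _ _ C n.+1)
    (fun n => @cell_disjoint _ _ C n.+1)
    (fun n => @cell_vertex_surj _ _ C n.+1)
    (fun n => @lifts_src _ _ C n.+1)
    (fun n => @lifts_rng _ _ C n.+1)
    (fun n => @lifts_sub _ _ C n.+1)
    (fun n => @lifts_edge _ _ C n.+1)
    (fun n => @lifts_ex _ _ C n.+1)
    (fun n => @lifts_uniq _ _ C n.+1)
    (fun n => @lifts_surj _ _ C n.+1).

(** Two cells inside [a] over one vertex are ends of lifted paths with common endpoints; if the
    paths agree, unique lifting identifies the cells. Conversely, parallel paths lifted from one
    cell end inside it over one vertex, and a path is recovered from the two ends of its lift. *)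
Lemma multitree_cover :
  multitree B <->
  forall n k (a : cell C n) (b b' : cell C k), (n <= k)%N ->
    cell_set b `<=` cell_set a -> cell_set b' `<=` cell_set a ->
    cell_vertex b = cell_vertex b' -> b = b'.
Proof.
split=> [mB n k a b b' nk ba b'a bb'|inj n k v u p q].
  have [v [u [p [c pcb]]]] := path_lifts_surj b nk.
  have [v' [u' [q [c' qc'b']]]] := path_lifts_surj b' nk.
  have [[x bx] [y b'y]] := (cell_nonempty b, cell_nonempty b').
  have ca : c = a := cell_disjoint (path_lifts_sub pcb bx) (ba _ bx).
  have c'a : c' = a := cell_disjoint (path_lifts_sub qc'b' b'y) (b'a _ b'y).
  subst c c'.
  have vv' : v = v' by rewrite -(path_lifts_src pcb) (path_lifts_src qc'b').
  have uu' : u = u'.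
    by rewrite -(path_lifts_rng pcb) bb' (path_lifts_rng qc'b').
  subst v' u'; rewrite (mB _ _ _ _ p q) in pcb.
  exact: path_lifts_uniq pcb qc'b'.
have [a av] := cell_vertex_surj C v.
have [[b pab] [b' qab']] := (path_lifts_ex p av, path_lifts_ex q av).
have bb' : b = b'.
  apply: (inj _ _ a) (dipath_leq p) _ _ _.
  - exact: path_lifts_sub pab.
  - exact: path_lifts_sub qab'.
  - by rewrite (path_lifts_rng pab) (path_lifts_rng qab').
by subst b'; exact: path_lifts_inj pab qab'.
Qed.

End derived_covers.

(** * Atoms of finite algebras *)

Section atoms.
Variables (X : topologicalType) (A : set (set X)).
Hypothesis algA : subalgebra A.

Lemma subalgebraI U V : A U -> A V -> A (U `&` V).
Proof.
case: algA => _ _ AC AU HU HV.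
by rewrite -[U]setCK -[V]setCK -setCU; apply/AC/AU; exact: AC.
Qed.

Lemma atom_sub a U x : atoms A a -> A U -> a x -> U x -> a `<=` U.
Proof.
move=> [Aa _ amin] AU ax Ux.
rewrite -(amin (a `&` U)); first exact: subIsetr.
- exact: subalgebraI.
- by exists x.
- exact: subIsetl.
Qed.

Lemma atom_eq a b x : atoms A a -> atoms A b -> a x -> b x -> a = b.
Proof.
move=> aa ab ax bx; have [[Aa _ _] [Ab _ _]] := (aa, ab).
apply/seteqP; split; first exact: atom_sub aa Ab ax bx.
exact: atom_sub ab Aa bx ax.
Qed.

Hypothesis finA : finite_set A.

(** The atom is built by running through the members of [A] and intersecting, for each of them, with
    whichever of it and its complement contains [x]. *)
Lemma atom_exists x : exists2 a, atoms A a & a x.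
Proof.
have [s sA] := (finite_seqP A).1 finA.
have Ass U : U \in s -> A U by rewrite sA.
suff [c [Ac cx cs]] : exists c, [/\ A c, c x &
    forall U, U \in s -> c `<=` U \/ c `<=` ~` U].
  exists c => //; split=> //; first by exists x.
  move=> b Ab [y b_y] bc; apply/seteqP; split=> //.
  have [//|cb] := cs b ltac:(by move: Ab; rewrite sA).
  by have := cb _ (bc _ b_y).
elim: s Ass {sA} => [_|U s IH Us].
  exists setT; split=> //; case: algA => _ A0 AC _.
  by rewrite -setC0; exact: AC.
have [V Vs|c [Ac cx cs]] := IH; first by apply: Us; rewrite inE Vs orbT.
have AU : A U by apply: Us; rewrite mem_head.
have [W [AW Wx WU]] : exists W, [/\ A W, W x & W = U \/ W = ~` U].
  have [Ux|Ux] := pselect (U x); first by exists U; split=> //; left.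
  by exists (~` U); split=> //; [case: algA => _ _ + _; exact|right].
exists (c `&` W); split=> //; first exact: subalgebraI.
move=> V; rewrite inE => /predU1P[->|/cs[]cV].
- by case: WU => <-; [left|right]; exact: subIsetr.
- by left; exact: subset_trans cV.
- by right; exact: subset_trans cV.
Qed.

End atoms.

(** * The cover of a Bratteli diagram by atoms *)

Section bratteli_cover.
Variables (X : topologicalType) (G : set (homeo X)) (D : decomposition G).

Lemma dgrp_mono i j : (i <= j)%N -> dgrp D i `<=` dgrp D j.
Proof.
elim: j => [|j IH]; first by rewrite leqn0 => /eqP ->.
rewrite leq_eqVlt => /predU1P[->//|/IH] h.
exact: subset_trans h (@dgrp_incr _ _ D j).
Qed.

Lemma dalg_mono i j : (i <= j)%N -> dalg D i `<=` dalg D j.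
Proof.
elim: j => [|j IH]; first by rewrite leqn0 => /eqP ->.
rewrite leq_eqVlt => /predU1P[->//|/IH] h.
exact: subset_trans h (@dalg_incr _ _ D j).
Qed.

Lemma dgrp_sub n : dgrp D n `<=` G.
Proof. by move=> g Gg; rewrite -(dgrp_union D); exists n. Qed.

Lemma dgrpM n g h : dgrp D n g -> dgrp D n h -> dgrp D n (g * h)%g.
Proof.
move=> gG hG; apply: set_mem.
exact: group_closedM (dgrp_subgroup D n) _ _ (mem_set gG) (mem_set hG).
Qed.

Lemma dgrpV n g : dgrp D n g -> dgrp D n (g^-1)%g.
Proof.
move=> gG; apply: set_mem.
exact: group_closedV (dgrp_subgroup D n) _ (mem_set gG).
Qed.

Lemma image_homeoK (g : homeo X) (U : set X) : (g^-1)%g @` (g @` U) = U.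
Proof.
rewrite image_comp -[RHS]image_id; apply: eq_imagel => x _.
exact: (homeoK g).
Qed.

Lemma image_homeoVK (g : homeo X) (U : set X) : g @` ((g^-1)%g @` U) = U.
Proof.
rewrite image_comp -[RHS]image_id; apply: eq_imagel => x _.
exact: (homeoVK g).
Qed.

Lemma tvertex_act n g a : dgrp D n g -> tvertex D n a -> tvertex D n (g @` a).
Proof.
move=> gG [Aa [x ax] amin]; split.
- exact: (dgrp_full D n).1.
- by exists (g x), x.
- move=> b Ab [y b_y] ba.
  rewrite -(amin ((g^-1)%g @` b)) ?image_homeoVK//.
  + by apply: (dgrp_full D n).1 => //; exact: dgrpV.
  + by exists ((g^-1)%g y), y.
  + by rewrite -(image_homeoK g a); exact: image_subset.
Qed.

Lemma gorbit_self (T : Type) (act : homeo X -> T -> T) n t :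
  act 1%g t = t -> gorbit act (dgrp D n) t t.
Proof. by move=> t1; exists 1%g => //; exact: dgrp1. Qed.

Lemma act_set1 (U : set X) : act_set 1%g U = U.
Proof. exact: image_id. Qed.

Lemma orbit_act_pair n g (e : set X * set X) : dgrp D n g ->
  gorbit (@act_pair X) (dgrp D n) (act_pair g e) =
  gorbit (@act_pair X) (dgrp D n) e.
Proof.
move=> gG; apply/seteqP; split=> _ [h hG <-].
  exists (h * g)%g; first exact: dgrpM.
  by rewrite /act_pair /= !image_comp.
exists (h * g^-1)%g; first by apply: dgrpM => //; exact: dgrpV.
case: e => a b; rewrite /act_pair /=; congr pair.
  by rewrite -[in RHS](image_homeoK g a) [RHS]image_comp.
by rewrite -[in RHS](image_homeoK g b) [RHS]image_comp.
Qed.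

(** The condition on stabilisers of atoms enters here; it is what makes lifts of edges unique. *)
Lemma dgrp_fix n g a b : tvertex D n a -> dgrp D n g -> g @` a = a ->
  b `<=` a -> g @` b = b.
Proof.
move=> aa gG ga ba.
have [_ gfix] : pointwise_stab (dgrp D n) a g by rewrite -dgrp_stab.
by rewrite -[RHS]image_id; apply: eq_imagel => x /ba/gfix.
Qed.

Program Definition bratteli_cover : tree_cover X (bratteli D) :=
  @TreeCover X (bratteli D) (fun n => tvertex D n) (fun n a => val a)
    (fun n a => gproj (@act_set X) (dgrp D n) a)
    (fun n e a b => val b `<=` val a /\
       val e = gorbit (@act_pair X) (dgrp D n) (val a, val b))
    _ _ _ _ _ _ _ _ _ _.
Next Obligation. by move=> n a; have [] := set_valP a. Qed.
Next Obligation.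
move=> n a b x ax bx; apply: val_inj.
exact: (atom_eq (dalg_subalgebra D n)) (set_valP a) (set_valP b) ax bx.
Qed.
Next Obligation.
move=> n [v vn]; have [a aa av] := set_mem vn.
by exists (SigSub (mem_set aa)); apply: val_inj.
Qed.
Next Obligation.
by move=> n e a b [_ eE]; apply: val_inj; rewrite /= eE source_orbitE.
Qed.
Next Obligation.
by move=> n e a b [_ eE]; apply: val_inj; rewrite /= eE range_orbitE.
Qed.
Next Obligation. by move=> n e a b []. Qed.
Next Obligation.
by move=> n e e' a b [_ eE] [_ e'E]; apply: val_inj; rewrite eE e'E.
Qed.
Next Obligation.
move=> n e a /(congr1 val) /=; case: e => _ /= /set_mem[[v w] [/= va wa wv] <-].
rewrite source_orbitE /= => av.
(* The representative [(v, w)] of the edge is translated so that its source becomes [a]; the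
   translate of [w] is the required cell. *)
have [g gG gva] : gorbit (@act_set X) (dgrp D n) v (val a).
  by rewrite -av; exact/gorbit_self/act_set1.
have gwa : tvertex D n.+1 (g @` w).
  by apply: tvertex_act => //; exact: dgrp_incr.
exists (SigSub (mem_set gwa)); split => /=.
  by rewrite -gva; exact: image_subset.
by rewrite -(orbit_act_pair (v, w) gG) /act_pair /= -gva.
Qed.
Next Obligation.
move=> n e a b b' [ba eE] [b'a]; rewrite eE => bb'.
(* Pairs over the same edge differ by some [g], which preserves [a] and hence fixes it pointwise,
   along with [b]. *)
have [g gG [ga gb]] :
    gorbit (@act_pair X) (dgrp D n) (val a, val b) (val a, val b').
  by rewrite bb'; exact/gorbit_self/act_pair1.
apply: val_inj; rewrite -[LHS](dgrp_fix (set_valP a) gG ga ba).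
exact: gb.
Qed.
Next Obligation.
move=> n b; have [Ab [x bx] _] := set_valP b.
have [a aa ax] := atom_exists (dalg_subalgebra D n) (dalg_finite D n) x.
have ba : val b `<=` a.
  apply: (atom_sub (dalg_subalgebra D n.+1)) (set_valP b) _ bx ax.
  by apply: dalg_incr; case: aa.
have eab : tedge D n (a, val b) by split => //; exact: set_valP.
exists (gproj (@act_pair X) (dgrp D n) (SigSub (mem_set eab))).
by exists (SigSub (mem_set aa)).
Qed.

Lemma gproj_eqP n (a b : tvertex D n) :
  gproj (@act_set X) (dgrp D n) a = gproj (@act_set X) (dgrp D n) b <->
  exists2 g, dgrp D n g & g @` val a = val b.
Proof.
split=> [/(congr1 val) /= ab|[g gG gab]].
  have [g gG gab] : gorbit (@act_set X) (dgrp D n) (val a) (val b).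
    by rewrite ab; exact/gorbit_self/act_set1.
  by exists g.
by apply: val_inj; rewrite /= -gab orbit_act_set.
Qed.

(** This is [multitree_cover] for the cover by atoms, where two cells over one vertex are translates
    under [dgrp D (m j)]. The bound [0 < i] reflects the deleted level. *)
Lemma multitree_telescoping (m : nat -> nat)
    (m_incr : {homo m : i j / (i < j)%N}) :
  multitree (drop_level0 (telescoping (bratteli D) m)) <->
  forall i j a b g, (0 < i <= j)%N -> tvertex D (m i) a ->
    tvertex D (m j) b -> dgrp D (m j) g ->
    b `<=` a -> g @` b `<=` a -> g @` b = b.
Proof.
pose C := drop_level0_cover (telescoping_cover bratteli_cover m_incr).
rewrite (multitree_cover C); split=> [inj|inj n k a b b' nk ba b'a].
  move=> [//|i] [//|j] a b g /= ij aa bb gG ba gba.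
  have gbb := tvertex_act gG bb.
  have /(congr1 val)//= : SigSub (mem_set gbb) = SigSub (mem_set bb).
  apply: (inj i j (SigSub (mem_set aa))) => //.
  by apply/esym/gproj_eqP; exists g.
move=> /gproj_eqP[g gG gbb']; apply: val_inj; rewrite -gbb'; apply/esym.
apply: (inj n.+1 k.+1 _ _ _ _ (set_valP a) (set_valP b) gG ba) => //.
by rewrite gbb'.
Qed.

(** * The two implications *)

Hypotheses (subG : subgroup G) (zdX : zero_dimensional X).

Lemma uniformly_discrete_multitree : uniformly_discrete G ->
  exists m : nat -> nat, {homo m : i j / (i < j)%N} /\
    multitree (drop_level0 (telescoping (bratteli D) m)).
Proof.
move=> [n [P [[Pcover _ _] Pclopen Puniq]]].
have /choice[N PN] i : exists k, dalg D k (P i).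
  by have := Pclopen i; rewrite -(dalg_union D) => -[k _]; exists k.
(* From level [M] on, the algebras contain every [P i], so each atom there lies in a single
   block. *)
pose M := \max_i N i; have m_incr : {homo addn M : i j / (i < j)%N}.
  by move=> i j; rewrite ltn_add2l.
exists (addn M); split=> //; apply/multitree_telescoping => //.
move=> i j a b g _ aa bb gG ba gba.
have [_ [x bx] _] := bb.
have [l _ Plx] : cover [set: 'I_n] P x by rewrite Pcover.
have aP : a `<=` P l.
  apply: (atom_sub (dalg_subalgebra D (M + i))) aa _ (ba _ bx) Plx.
  by apply: dalg_mono (PN l); rewrite (leq_trans (leq_bigmax l)) ?leq_addr.
have gbx : (g @` b) (g x) by exists x.
(* Both points lie in the block [P l] and in one orbit of [G]. *)
have gx : g x = x.
  apply: (Puniq x l); split.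
  - by exists g => //; exact: dgrp_sub gG.
  - exact/aP/gba.
  - by exists 1%g => //; case: subG => /set_mem.
  - exact/aP/ba.
rewrite gx in gbx.
exact: (atom_eq (dalg_subalgebra D (M + j))) (tvertex_act gG bb) bb gbx bx.
Qed.

Lemma multitree_uniformly_discrete (m : nat -> nat) :
  {homo m : i j / (i < j)%N} ->
  multitree (drop_level0 (telescoping (bratteli D) m)) ->
  uniformly_discrete G.
Proof.
move=> m_incr /(multitree_telescoping m_incr) inj.
have m_ge i : (i <= m i)%N.
  by elim: i => // i /leq_ltn_trans; apply; exact: m_incr.
have m_mono i j : (i <= j)%N -> (m i <= m j)%N.
  by rewrite leq_eqVlt => /predU1P[->//|/m_incr/ltnW].
(* The partition witnessing discreteness consists of the atoms of the first level kept. *)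
set A := tvertex D (m 1%N).
have algA := dalg_subalgebra D (m 1%N).
have finA : finite_set A.
  by apply: sub_finite_set (dalg_finite D (m 1%N)) => ? [].
have [s sA] := (finite_seqP A).1 finA.
(* Without repetitions, distinct indices give distinct, hence disjoint, atoms. *)
pose t := undup s.
have At i : A (tnth (in_tuple t) i).
  by have := mem_tnth i (in_tuple t); rewrite mem_undup sA.
exists (size t), (tnth (in_tuple t)); split.
- split.
  + apply/seteqP; split=> // x _.
    have [a aa ax] := atom_exists algA (dalg_finite D (m 1%N)) x.
    have : A a by []; rewrite sA /= -mem_undup => /(tnthP (in_tuple t))[i ai].
    by exists i => //; rewrite -ai.
  + apply/trivIsetP => i j _ _ ij; rewrite -subset0 => x [ix jx].
    have /eqP := atom_eq algA (At i) (At j) ix jx.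
    rewrite !(tnth_nth set0) nth_uniq ?undup_uniq//= => ijE.
    by move: ij; rewrite -val_eqE /= ijE.
  + by move=> i _; have [] := At i.
- move=> i; rewrite -(dalg_union D); exists (m 1%N) => //.
  by have [] := At i.
move=> x i y z [[g gG gx] iy] [[h hG hx] iz].
apply/eqP/negPn/negP => /eqP yz.
have [k kG ky] : exists2 k, G k & k y = z.
  exists (h * g^-1)%g; last by rewrite -gx -hx /=; congr (h _); exact: homeoK.
  apply: set_mem; apply: group_closedM => //; first exact: mem_set.
  by apply: group_closedV => //; exact: mem_set.
(* A clopen set separating [y] from [z] will be contradicted by a small atom around [y]. *)
have [U [+ Uy Uz]] := zdX (introN eqP yz).
rewrite -(dalg_union D) => -[j1 _ AU].
move: kG; rewrite -(dgrp_union D) => -[j2 _ kG].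
(* At level [m j] the algebra contains [U] and the group contains [k]; the successor ensures
   [1 <= j]. *)
pose j := (maxn j1 j2).+1.
have AjU : dalg D (m j) U.
  by apply: dalg_mono AU; rewrite (leq_trans _ (m_ge j))// leqW ?leq_maxl.
have kj : dgrp D (m j) k.
  by apply: dgrp_mono kG; rewrite (leq_trans _ (m_ge j))// leqW ?leq_maxr.
have algj := dalg_subalgebra D (m j).
have [b bb b_y] := atom_exists algj (dalg_finite D (m j)) y.
have Ai : dalg D (m j) (tnth (in_tuple t) i).
  by apply: (@dalg_mono (m 1%N)); [exact: m_mono|case: (At i)].
have kbz : (k @` b) z by exists y.
have kb : k @` b = b.
  apply: (inj 1%N j _ _ _ _ (At i) bb kj) => //.
  - exact: (atom_sub algj bb Ai b_y iy).
  - exact: (atom_sub algj (tvertex_act kj bb) Ai kbz iz).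
(* Since [k] preserves [b], the point [z] lies in [b], which is contained in [U]. *)
apply: Uz; apply: (atom_sub algj bb AjU b_y Uy).
by rewrite -kb.
Qed.

End bratteli_cover.

Theorem theorem3p2 (G : set (homeo cantor_space)) (ampleG : ample G)
    (D : decomposition G) :
  uniformly_discrete G <->
  exists m : nat -> nat,
    {homo m : i j / (i < j)%N} /\
    multitree (drop_level0 (telescoping (bratteli D) m)).
Proof.
have [subG _ _ _ _] := ampleG.
split; first exact: uniformly_discrete_multitree.
move=> [m [m_incr mt]].
exact: multitree_uniformly_discrete subG cantor_zero_dimensional m m_incr mt.
Qed.
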